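(* Let $K$ be a field, let $S=K[x_1,\ldots,x_n]$ and $\mathfrak m=(x_1,\ldots,x_n)S$. Let $\Delta$ be a simplicial complex on $[n]$ with $\dim\Delta\ge 1$ and let $I_\Delta\subseteq S$ be its Stanley-Reisner ideal. Then the following conditions are equivalent: (1) $\operatorname{depth} S/I_\Delta^{(2)}\ge 2$ (equivalently, $\operatorname{depth}(S/I_\Delta^{(2)})_{\mathfrak m}\ge 2$). (2) $\operatorname{diam}\Delta^{(1)}\le 2$, where $\Delta^{(1)}$ denotes the $1$-skeleton of $\Delta$.
   Context: A simplicial complex on $V=[n]$ is a nonempty subset $\Delta\subseteq 2^V$ closed under taking subsets and with $\{v\}\in\Delta$ for all $v\in V$; $\dim F=\sharp(F)-1$ for a face $F$, and $\dim\Delta$ is the maximum of these. The Stanley-Reisner ideal $I_\Delta$ is generated by all squarefree monomials $x_{i_1}\cdots x_{i_p}$ with $\{i_1<\cdots<i_p\}\notin\Delta$. The second symbolic power is $I_\Delta^{(2)}=\bigcap_{F} P_F^2$, where $F$ runs over the facets (maximal faces) of $\Delta$ and $P_F=(x_i : i\in[n]\setminus F)$. Depth of the graded ring $S/I$ is with respect to $\mathfrak m$. The $1$-skeleton $\Delta^{(1)}=\{F\in\Delta:\dim F\le1\}$ is regarded as a graph on $V$ whose edges are the $1$-dimensional faces. The diameter of a connected graph is the maximal distance (minimal length of a path) between two vertices, and the diameter of a disconnected graph is $\infty$. *)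

(* Defs.v *)
From HB Require Import structures.
From mathcomp Require Import all_boot all_order all_algebra.
From mathcomp Require Import fraction boolp.
From mathcomp Require Import mpoly.

Set Implicit Arguments.
Unset Strict Implicit.
Unset Printing Implicit Defensive.

Import GRing.Theory.
Local Open Scope ring_scope.

(* Ideals of a commutative ring are handled as Prop-valued predicates. *)
Section Ideals.
Variable R : comNzRingType.

Definition ideal_gen (G : R -> Prop) (x : R) : Prop :=
  exists2 s : seq (R * R),
    forall cg, cg \in s -> G cg.2 & x = \sum_(cg <- s) cg.1 * cg.2.

Definition ideal_mul (I J : R -> Prop) : R -> Prop :=
  ideal_gen (fun x => exists a b, [/\ I a, J b & x = a * b]).

Definition ideal_sq (I : R -> Prop) : R -> Prop := ideal_mul I I.

Definition ideal_adjoin (I : R -> Prop) (s : seq R) : R -> Prop :=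
  ideal_gen (fun x => I x \/ x \in s).

(* [s] is a regular sequence on the R-module R/I: s_i is a nonzerodivisor on
   R/(I + (s_0, ..., s_(i-1))), and R/(I + (s)) is not zero. *)
Definition regular_seq (I : R -> Prop) (s : seq R) : Prop :=
  (forall i, (i < size s)%N -> forall g,
     ideal_adjoin I (take i s) (s`_i * g) -> ideal_adjoin I (take i s) g)
  /\ ~ ideal_adjoin I s 1.

(* depth of R/I with respect to the ideal J, i.e. the supremum of the lengths
   of the (R/I)-regular sequences of elements of J, is at least k. *)
Definition depth_geq (J I : R -> Prop) (k : nat) : Prop :=
  exists s : seq R,
    [/\ forall x, x \in s -> J x, regular_seq I s & (k <= size s)%N].

Lemma ideal_gen0 G : ideal_gen G 0.
Proof. by exists [::] => [//|]; rewrite big_nil. Qed.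

Lemma ideal_genD G x y : ideal_gen G x -> ideal_gen G y -> ideal_gen G (x + y).
Proof.
move=> [s sG ->] [t tG ->]; exists (s ++ t); last by rewrite big_cat.
by move=> cg; rewrite mem_cat => /orP[/sG|/tG].
Qed.

Lemma ideal_genMl G a x : ideal_gen G x -> ideal_gen G (a * x).
Proof.
move=> [s sG ->]; exists [seq (a * cg.1, cg.2) | cg <- s].
  by move=> cg /mapP[cg' /sG ? ->].
by rewrite big_map mulr_sumr; apply: eq_bigr => cg _; rewrite mulrA.
Qed.

Lemma ideal_gen_mem (G : R -> Prop) x : G x -> ideal_gen G x.
Proof.
move=> Gx; exists [:: (1, x)]; last by rewrite big_seq1 mul1r.
by move=> cg; rewrite inE => /eqP->.
Qed.

Lemma ideal_gen_sub (G H : R -> Prop) x :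
  (forall y, G y -> ideal_gen H y) -> ideal_gen G x -> ideal_gen H x.
Proof.
move=> GH [s sG ->]; rewrite big_seq; apply: big_ind => [|y z|cg /sG /GH].
- exact: ideal_gen0.
- exact: ideal_genD.
- exact: ideal_genMl.
Qed.

End Ideals.

Definition ideal_ext (R R' : comNzRingType) (f : R -> R') (I : R -> Prop) :
  R' -> Prop := ideal_gen (fun y => exists2 x, I x & y = f x).

Section MonomialIdeals.
Variables (K : fieldType) (n : nat).
Local Notation S := {mpoly K[n]}.

Definition monomial_ideal (G : 'X_{1..n} -> Prop) : S -> Prop :=
  ideal_gen (fun f => exists2 m, G m & f = 'X_[m]).

Definition var_ideal (A : {set 'I_n}) : S -> Prop :=
  ideal_gen (fun f => exists2 i, i \in A & f = 'X_i).

Definition max_ideal : S -> Prop := var_ideal [set: 'I_n].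

Lemma monomial_idealP G (f : S) :
  monomial_ideal G f <->
  (forall m, m \in msupp f -> exists2 m', G m' & (m' <= m)%MM).
Proof.
split=> [[s sG ->] m /msupp_sum_le/flattenP/= [l /mapP[cg + ->]] | Gf].
  rewrite filter_predT => /sG [m' Gm' ->].
  rewrite (perm_mem (msuppMX _ _)) => /mapP[m'' _ ->].
  by exists m' => //; rewrite lem_addr.
rewrite [f]mpolyE big_seq; apply: big_ind => [|g h|m /Gf[m' Gm' le_m'm]].
- exact: ideal_gen0.
- exact: ideal_genD.
rewrite -(submK le_m'm) mpolyXD scalerAl.
by apply: ideal_genMl; apply: ideal_gen_mem; exists m'.
Qed.

Lemma var_idealE A (f : S) :
  var_ideal A f <-> monomial_ideal (fun m => exists2 i, i \in A & m = U_(i)%MM) f.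
Proof.
split; apply: ideal_gen_sub => g.
  move=> [i Ai ->]; apply: ideal_gen_mem.
  by exists U_(i)%MM => //; exists i.
by move=> [m [i Ai ->] ->]; apply: ideal_gen_mem; exists i.
Qed.

Lemma var_idealP A (f : S) :
  var_ideal A f <->
  (forall m, m \in msupp f -> exists2 i, i \in A & (0 < m i)%N).
Proof.
rewrite var_idealE monomial_idealP; split=> Af m /Af.
  move=> [_ [i Ai ->] /mnm_lepP/(_ i)].
  by rewrite mnm1E eqxx; exists i.
move=> [i Ai mi]; exists U_(i)%MM; first by exists i.
by apply/mnm_lepP => j; rewrite mnm1E; case: eqP => // <-.
Qed.

Lemma max_idealP (f : S) : max_ideal f <-> f@_0%MM = 0.
Proof.
rewrite /max_ideal var_idealP; split=> [mf | f0 m mf].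
  apply/eqP; rewrite mcoeff_eq0; apply/negP => /mf[i _].
  by rewrite mnm0E.
have: m != 0%MM by apply: contraTneq mf => ->; rewrite -mcoeff_eq0 f0.
move=> m_neq0; have [/existsP[i mi]|] := boolP [exists i, 0 < m i]%N.
  by exists i; rewrite ?inE.
move=> /existsPn m0; case/eqP: m_neq0; apply/mnmP => i.
by rewrite mnm0E; apply/eqP; rewrite eqn0Ngt m0.
Qed.

End MonomialIdeals.

(* The localization S_m, realized as the subring of Frac S formed by the
   fractions whose denominator is not in m. *)
Section Localization.
Variables (K : fieldType) (n : nat).
Local Notation S := {mpoly K[n]}.

Definition loc_pred : {pred {fraction S}} :=
  fun x => `[< exists f g : S, ~ max_ideal g /\ x = tofrac f / tofrac g >].

Lemma notin_max_idealM (f g : S) :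
  ~ max_ideal f -> ~ max_ideal g -> ~ max_ideal (f * g).
Proof.
rewrite !max_idealP => /eqP f0 /eqP g0.
by apply/eqP; rewrite rmorphM mulf_neq0.
Qed.

Lemma notin_max_ideal_neq0 (f : S) : ~ max_ideal f -> tofrac f != 0.
Proof.
by move=> mf; rewrite tofrac_eq0; apply: contra_notN mf => /eqP->; exact: ideal_gen0.
Qed.

Lemma notin_max_ideal1 : ~ max_ideal (1 : S).
Proof. by rewrite max_idealP rmorph1; apply/eqP; rewrite oner_eq0. Qed.

Lemma loc_subring_closed : GRing.subring_closed loc_pred.
Proof.
split=> [|x y|x y].
- apply/asboolP; exists 1, 1; split; first exact: notin_max_ideal1.
  by rewrite tofrac1 divr1.
- move=> /asboolP[f [g [mg ->]]] /asboolP[f' [g' [mg' ->]]]; apply/asboolP.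
  exists (f * g' - f' * g), (g * g'); split; first exact: notin_max_idealM.
  have [g0 g'0] := (notin_max_ideal_neq0 mg, notin_max_ideal_neq0 mg').
  by rewrite -mulNr addf_div // tofracB !tofracM mulNr.
- move=> /asboolP[f [g [mg ->]]] /asboolP[f' [g' [mg' ->]]]; apply/asboolP.
  exists (f * f'), (g * g'); split; first exact: notin_max_idealM.
  by rewrite !tofracM mulf_div.
Qed.

HB.instance Definition _ :=
  GRing.isSubringClosed.Build {fraction S} loc_pred loc_subring_closed.

Record loc_ring := LocRing { loc_val :> {fraction S}; loc_valP : loc_val \in loc_pred }.

HB.instance Definition _ := [isSub for loc_val].
HB.instance Definition _ := [Choice of loc_ring by <:].
HB.instance Definition _ := [SubChoice_isSubComNzRing of loc_ring by <:].

Lemma to_loc_subproof (f : S) : tofrac f \in loc_pred.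
Proof.
apply/asboolP; exists f, 1; split; first exact: notin_max_ideal1.
by rewrite tofrac1 divr1.
Qed.

Definition to_loc (f : S) : loc_ring := LocRing (to_loc_subproof f).

End Localization.

Section SimplicialComplexes.
Variable n : nat.
Implicit Types (D : {set {set 'I_n}}) (F G : {set 'I_n}).

Definition simplicial_complex D : Prop :=
  [/\ D != set0,
      forall F G, F \in D -> G \subset F -> G \in D
    & forall v : 'I_n, [set v] \in D].

Definition face_dim F : int := #|F|%:Z - 1.

Definition complex_dim D : int := (\max_(F in D) #|F|)%N%:Z - 1.

Definition facet D F : bool := maxset (mem D) F.

Definition skeleton1 D : {set {set 'I_n}} := [set F in D | face_dim F <= 1].

Definition skeleton1_adj D : rel 'I_n :=
  fun u v => (u != v) && ([set u; v] \in skeleton1 D).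

End SimplicialComplexes.

Section StanleyReisner.
Variables (K : fieldType) (n : nat).
Implicit Types (D : {set {set 'I_n}}) (F : {set 'I_n}).

Definition stanley_reisner D : {mpoly K[n]} -> Prop :=
  ideal_gen (fun f => exists2 F, F \notin D & f = \prod_(i in F) 'X_i).

Definition facet_prime F : {mpoly K[n]} -> Prop := var_ideal (~: F).

(* The second symbolic power of [stanley_reisner D]; by [stanley_reisnerP]
   the primes P_F, F a facet, are the components of that radical ideal. *)
Definition sr_symbolic_square D (f : {mpoly K[n]}) : Prop :=
  forall F, facet D F -> ideal_sq (facet_prime F) f.

Lemma stanley_reisnerE D (f : {mpoly K[n]}) :
  stanley_reisner D f <->
  monomial_ideal (fun m => exists2 F, F \notin D & m = (\sum_(i in F) U_(i))%MM) f.
Proof.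
split; apply: ideal_gen_sub => g.
  move=> [F DF ->]; apply: ideal_gen_mem; exists (\sum_(i in F) U_(i))%MM.
    by exists F.
  by rewrite mprodXE.
by move=> [m [F DF ->] ->]; apply: ideal_gen_mem; exists F => //; rewrite mprodXE.
Qed.

Lemma stanley_reisnerP D (f : {mpoly K[n]}) : simplicial_complex D ->
  stanley_reisner D f <-> (forall F, facet D F -> facet_prime F f).
Proof.
move=> [_ Dsub _].
have supp1 (F : {set 'I_n}) j : (\sum_(i in F) U_(i))%MM j = (j \in F).
  rewrite mnm_sumE; under eq_bigr do rewrite mnm1E.
  have [Fj|nFj] := boolP (j \in F).
    rewrite (bigD1 j) //= eqxx big1 // => i /andP[_ /negPf nij].
    by rewrite nij.
  by rewrite big1 // => i Fi; case: eqP nFj => // <-; rewrite Fi.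
rewrite stanley_reisnerE monomial_idealP; split=> [Df F /maxsetP[DF _]|Df m mf].
  apply/var_idealP => m /Df[_ [G DG ->] /mnm_lepP le_Gm].
  have /subsetPn[i Gi Fi] : ~~ (G \subset F) by apply: contra DG => /(Dsub _ _ DF).
  by exists i; [rewrite inE | have := le_Gm i; rewrite supp1 Gi].
pose A := [set i | 0 < m i]%N; exists (\sum_(i in A) U_(i))%MM; last first.
  by apply/mnm_lepP => i; rewrite supp1 inE; case: (m i).
exists A => //; apply/negP => Dm.
have [F Fmax mF] := maxset_exists (P := mem D) Dm.
have /var_idealP/(_ m mf)[i] := Df F Fmax.
by rewrite inE => /negP Fi mi; apply: Fi; apply: (subsetP mF); rewrite inE.
Qed.

End StanleyReisner.

Section Graphs.
Variables (T : finType) (e : rel T).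

Definition has_path (k : nat) (u v : T) : bool :=
  [exists p : k.-tuple T, path e u p && (last u p == v)].

(* The least k < #|T| such that [has_path k u v]; as a shortest path repeats no
   vertex this is the distance whenever u and v are connected. *)
Definition distance (u v : T) : nat := find (fun k => has_path k u v) (iota 0 #|T|).

(* [None] is the value oo, taken when the graph is disconnected. *)
Definition diameter : option nat :=
  if [forall u, forall v, connect e u v]
  then Some (\max_u \max_v distance u v)%N else None.

Lemma distanceP u v : connect e u v ->
  has_path (distance u v) u v /\
  (forall p, path e u p -> last u p = v -> (distance u v <= size p)%N).
Proof.
have short p : path e u p -> last u p = v ->
    exists2 k, (k < #|T|)%N && (k <= size p)%N & has_path k u v.
  move=> ep pv; have [q eq_ uq sub] := shortenP ep.
  move: pv; case: (shortenP ep) => p' ep' up' sp' lp'.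
  exists (size p'); last by apply/existsP; exists (in_tuple p'); rewrite ep' lp' /=.
  apply/andP; split.
    by rewrite -[X in (X <= _)%N]/(size (u :: p')) -(card_uniqP up') max_card.
  by apply: uniq_leq_size => //; case/andP: up'.
move=> /connectP[p ep pv]; have [k /andP[kT _] uvk] := short p ep (esym pv).
have hask : has (fun k => has_path k u v) (iota 0 #|T|).
  by apply/hasP; exists k => //; rewrite mem_iota.
split=> [|q eq_ qv].
  have := nth_find 0%N hask; rewrite nth_iota ?add0n //.
  by move: hask; rewrite has_find size_iota.
have [j /andP[jT jq] uvj] := short q eq_ qv.
apply: leq_trans jq; rewrite leqNgt; apply/negP => j_lt.
by have := before_find 0%N j_lt; rewrite nth_iota // add0n uvj.
Qed.

End Graphs.

Definition ext_leq (d : option nat) (k : nat) : bool :=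
  if d is Some m then (m <= k)%N else false.

(* Main.v *)
Require Import Defs.
From HB Require Import structures.
From mathcomp Require Import all_boot all_order all_algebra.
From mathcomp Require Import fraction boolp.
From mathcomp Require Import mpoly ring.

Set Implicit Arguments.
Unset Strict Implicit.
Unset Printing Implicit Defensive.

Import GRing.Theory.
Local Open Scope ring_scope.

(** The theorem is the statement that the functions on the punctured spectrum
of [S/I2] are the elements of [S/I2] itself exactly when the graph has diameter
at most 2.  Only monomials matter: [f] is in [I2] iff no monomial of [f] has
total exponent at most 1 outside some facet ([symbolic_squareP]).

If the diameter exceeds 2, choose [u], [v] with disjoint closed neighbourhoods,
and let [N] be that of [u].  Modulo [I2] the monomial [X_u X_v] annihilates
every product [X_k X_l] with [k] in [N] and [l] outside ([far_product]), so it
splits into a part living near [u] and a part living near [v]: sending [f] to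
[X_u X_v] times the [N]-part of [f] is a linear map from the maximal ideal to
[S/I2].  For a regular sequence of length 2 in the maximal ideal such a map
would be multiplication by some [w]; the values at [X_u] and [X_v] impose
incompatible coefficients of [X_u X_v] in [w] ([far_not_regular]).  The
argument tolerates denominators outside the maximal ideal, so it excludes depth
2 after localization as well, and since regular sequences localize
([depth_geq_loc]), both equivalences follow from one cycle of implications.

If the diameter is at most 2, the elementary symmetric polynomials [e1], [e2]
form a regular sequence.  Regularity of [e1] holds because each [P_F^2] is
primary and [e1] is in no [P_F].  Suppose [e2 f] is in [I2 + (e1)].  After
inverting [X_i], only the facets through [i] survive, and eliminating [X_i] by
means of [e1] turns [e2] into an element outside each remaining [P_F]; this
yields [w_i] with [X_i^2 f = w_i e1] modulo [I2] ([local_quotient]).  The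
fractions [w_i / X_i^2] agree on overlaps, and gluing them is a question about
each monomial [x^m] separately: the facets [F] with exponent sum at most 1
outside [F] have to form a connected family, which is what diameter at most 2
ensures ([facet_weight_connected]).  The glued element is a quotient of [f] by
[e1]. *)

(** * Ideals and regular sequences of length 2 *)

Section IdealTheory.
Variable R : comNzRingType.
Implicit Types (I J G : R -> Prop) (s : seq R).

Definition is_ideal I : Prop :=
  [/\ I 0, forall x y, I x -> I y -> I (x + y) & forall a x, I x -> I (a * x)].

Lemma ideal_gen_is_ideal G : is_ideal (ideal_gen G).
Proof.
by split; [exact: ideal_gen0 | exact: ideal_genD | exact: ideal_genMl].
Qed.

Lemma ideal_gen_min J G : is_ideal J -> (forall y, G y -> J y) ->
  forall x, ideal_gen G x -> J x.
Proof.
move=> [J0 JD JM] GJ _ [s sG ->]; rewrite big_seq.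
by apply: big_ind => // cg /sG /GJ; apply: JM.
Qed.

Lemma idealB I x y : is_ideal I -> I x -> I y -> I (x - y).
Proof. by move=> [_ ID IM] Ix /(IM (-1)); rewrite mulN1r; apply: ID. Qed.

Lemma ideal_adjoin_nil I x : is_ideal I -> ideal_adjoin I [::] x <-> I x.
Proof.
move=> II; split; last by move=> Ix; apply: ideal_gen_mem; left.
by apply: ideal_gen_min => // y [].
Qed.

Lemma ideal_adjoin1 I x f : is_ideal I ->
  ideal_adjoin I [:: x] f <-> exists q, I (f - q * x).
Proof.
move=> II; have [I0 ID IM] := II; split.
  apply: (ideal_gen_min (J := fun f => exists q, I (f - q * x))) => [|y [Iy|]].
  - split=> [|g h [q Iq] [r Ir]|a g [q Iq]].
    + by exists 0; rewrite mul0r subrr.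
    + by exists (q + r); rewrite mulrDl opprD addrACA; apply: ID.
    + by exists (a * q); rewrite -mulrA -mulrBr; apply: IM.
  - by exists 0; rewrite mul0r subr0.
  - by rewrite inE => /eqP->; exists 1; rewrite mul1r subrr.
move=> [q Iq]; rewrite -(subrK (q * x) f); apply: ideal_genD.
  by apply: ideal_gen_mem; left.
by apply: ideal_genMl; apply: ideal_gen_mem; right; rewrite inE.
Qed.

Lemma ideal_adjoin_min I J s x : is_ideal J -> (forall y, I y -> J y) ->
  (forall y, y \in s -> J y) -> ideal_adjoin I s x -> J x.
Proof. by move=> JJ IJ sJ; apply: ideal_gen_min => // y [/IJ|/sJ]. Qed.

Lemma regular_seq_pair I x y : is_ideal I ->
    (forall g, I (x * g) -> I g) ->
    (forall g h, I (y * g - h * x) -> exists q, I (g - q * x)) ->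
    ~ ideal_adjoin I [:: x; y] 1 ->
  regular_seq I [:: x; y].
Proof.
move=> II regx regy proper; split=> // -[|[|//]] _ g /=.
  by rewrite !ideal_adjoin_nil //; apply: regx.
by rewrite !ideal_adjoin1 // => -[h /regy].
Qed.

Lemma regular_seq_two I s : is_ideal I -> regular_seq I s -> (2 <= size s)%N ->
  (forall g, I (s`_0 * g) -> I g) /\
  (forall g h, I (s`_1 * g - h * s`_0) -> exists q, I (g - q * s`_0)).
Proof.
move=> II [reg _] s2; split=> [g|g h].
  have /(_ g) := reg 0%N (ltnW s2).
  by rewrite take0 !ideal_adjoin_nil.
have /(_ g) := reg 1%N s2.
rewrite (take_nth 0) ?(ltnW s2) // take0 /= !ideal_adjoin1 // => H Ih.
by apply: H; exists h.
Qed.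

End IdealTheory.

Lemma preim_is_ideal (R R' : comNzRingType) (f : {rmorphism R -> R'})
    (J : R' -> Prop) : is_ideal J -> is_ideal (fun x => J (f x)).
Proof.
move=> [J0 JD JM]; split=> [|x y Jx Jy|a x Jx].
- by rewrite rmorph0.
- by rewrite rmorphD; apply: JD.
- by rewrite rmorphM; apply: JM.
Qed.

(** * Depth and localization *)

Section LocalDepth.
Variables (R L : comNzRingType) (m : R -> Prop) (loc : {rmorphism R -> L}).
Implicit Types (I J : R -> Prop) (f g t : R).

(** What the transfer of depth uses of the localization map at a prime [m] of a
domain. *)
Record localization_at : Prop := LocalizationAt {
  loc_max_ideal : is_ideal m;
  loc_nmax1 : ~ m 1;
  loc_nmaxM : forall f g, ~ m f -> ~ m g -> ~ m (f * g);
  loc_inj : injective loc;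
  loc_unit : forall t, ~ m t -> exists u, loc t * u = 1;
  loc_frac : forall h, exists t f, ~ m t /\ loc t * h = loc f }.

Hypothesis locP : localization_at.

Lemma ideal_ext_locP J h : is_ideal J ->
  ideal_ext loc J h <-> exists t f, [/\ ~ m t, J f & loc t * h = loc f].
Proof.
move=> JJ; have [J0 JD JM] := JJ; split; last first.
  move=> [t [f [/(loc_unit locP)[u tu] Jf hf]]].
  rewrite -[h]mul1r -tu mulrAC hf mulrC; apply: ideal_genMl.
  by apply: ideal_gen_mem; exists f.
pose E h := exists t f, [/\ ~ m t, J f & loc t * h = loc f].
apply: (ideal_gen_min (J := E)) => [|_ [f Jf ->]]; last first.
  by exists 1, f; split; rewrite ?rmorph1 ?mul1r //; apply: (loc_nmax1 locP).
split.
- by exists 1, 0; split; rewrite ?raddf0 ?mulr0 //; apply: (loc_nmax1 locP).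
- move=> x y [t [f [mt Jf xf]]] [t' [f' [mt' Jf' yf']]].
  exists (t * t'), (t' * f + t * f'); split; first exact: (loc_nmaxM locP).
    by apply: JD; apply: JM.
  by rewrite rmorphD !rmorphM /= -xf -yf'; ring.
- move=> a x [t [f [mt Jf xf]]]; have [t' [b [mt' ab]]] := loc_frac locP a.
  exists (t * t'), (b * f); split; [exact: (loc_nmaxM locP) | exact: JM |].
  by rewrite !rmorphM /= -xf -ab; ring.
Qed.

Lemma ideal_contr_locP J f : is_ideal J ->
  ideal_ext loc J (loc f) <-> exists2 t, ~ m t & J (t * f).
Proof.
move=> JJ; rewrite ideal_ext_locP //; split.
  move=> [t [g [mt Jg]]]; rewrite -rmorphM => /(loc_inj locP) gE.
  by exists t; rewrite ?gE.
by move=> [t mt Jf]; exists t, (t * f); rewrite rmorphM.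
Qed.

Lemma ideal_ext_is_ideal J : is_ideal (ideal_ext loc J).
Proof. exact: ideal_gen_is_ideal. Qed.

Lemma ideal_adjoin_ext I s h :
  ideal_adjoin (ideal_ext loc I) (map loc s) h <->
  ideal_ext loc (ideal_adjoin I s) h.
Proof.
split.
  apply: ideal_gen_min => [|y [|/mapP[f fs ->]]].
  - exact: ideal_gen_is_ideal.
  - apply: ideal_gen_sub => _ [f If ->]; apply: ideal_gen_mem; exists f => //.
    by apply: ideal_gen_mem; left.
  - by apply: ideal_gen_mem; exists f => //; apply: ideal_gen_mem; right.
apply: ideal_gen_min => [|_ [f If ->]]; first exact: ideal_gen_is_ideal.
move: f If.
pose E f := ideal_adjoin (ideal_ext loc I) (map loc s) (loc f).
apply: (ideal_gen_min (J := E)) => [|f [If|fs]]; rewrite /E.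
- exact/preim_is_ideal/ideal_gen_is_ideal.
- by apply: ideal_gen_mem; left; apply: ideal_gen_mem; exists f.
- by apply: ideal_gen_mem; right; rewrite map_f.
Qed.

(** Flatness of localization, by hand: a relation over the localization becomes,
once denominators are cleared, a relation over [R], and denominators are units.
The quotient stays nonzero since the ideal is inside [m]. *)
Lemma regular_seq_loc I s : is_ideal I -> (forall f, I f -> m f) ->
    (forall f, f \in s -> m f) -> regular_seq I s ->
  regular_seq (ideal_ext loc I) (map loc s).
Proof.
move=> II Im sm [reg _].
have adj s' : is_ideal (ideal_adjoin I s') by apply: ideal_gen_is_ideal.
split=> [i|]; last first.
  rewrite ideal_adjoin_ext -(rmorph1 loc) ideal_contr_locP // => -[t mt].
  rewrite mulr1; apply: contra_not mt; apply: ideal_adjoin_min => //.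
  exact: loc_max_ideal.
rewrite size_map => lt_i h; rewrite -map_take !ideal_adjoin_ext.
have [t [f [mt hf]]] := loc_frac locP h.
rewrite (nth_map 0) // => /ideal_ext_locP; case=> // t' [g [mt' Ig]].
have [u tu] := loc_unit locP mt.
rewrite -[h]mul1r -tu mulrAC hf => gE.
rewrite mulrC; apply: ideal_genMl.
apply/ideal_contr_locP=> //; exists t' => //; apply: reg => //.
have -> : s`_i * (t' * f) = t * g.
  apply: (loc_inj locP); rewrite !rmorphM /= -gE.
  by rewrite -[LHS]mul1r -tu; ring.
by case: (adj (take i s)) => _ _; apply.
Qed.

Lemma depth_geq_loc I k : is_ideal I -> (forall f, I f -> m f) ->
  depth_geq m I k -> depth_geq (ideal_ext loc m) (ideal_ext loc I) k.
Proof.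
move=> II Im [s [sm reg ks]]; exists (map loc s); split.
- by move=> _ /mapP[f fs ->]; apply: ideal_gen_mem; exists f => //; apply: sm.
- exact: regular_seq_loc.
- by rewrite size_map.
Qed.

(** The two elements may be replaced by multiples with unit factors, hence taken
in [R]; regularity then holds over [R] up to denominators outside [m]. *)
Lemma local_depth2_lift I : is_ideal I ->
    depth_geq (ideal_ext loc m) (ideal_ext loc I) 2 ->
  exists x y, [/\ m x, m y,
    forall g, I (x * g) -> exists2 t, ~ m t & I (t * g)
  & forall g h, I (y * g - h * x) ->
      exists2 t, ~ m t & exists q, I (t * g - q * x)].
Proof.
move=> II [s [sm reg s2]].
have [regx regy] := regular_seq_two (ideal_ext_is_ideal I) reg s2.
have mx : ideal_ext loc m s`_0 by apply/sm/mem_nth/ltnW.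
have my : ideal_ext loc m s`_1 by apply/sm/mem_nth.
move: s`_0 s`_1 regx regy mx my => X Y regX regY.
move=> /(ideal_ext_locP _ (loc_max_ideal locP)) [a [x [ma mx aX]]].
move=> /(ideal_ext_locP _ (loc_max_ideal locP)) [b [y [mb my bY]]].
have ext f : I f -> ideal_ext loc I (loc f).
  by move=> If; apply: ideal_gen_mem; exists f.
exists x, y; split=> // [g Ixg|g h Iygh].
  have /regX/(ideal_contr_locP _ II)[t mt] : ideal_ext loc I (X * loc (a * g)).
    rewrite rmorphM /= mulrCA mulrA aX -rmorphM; exact: ext.
  by rewrite mulrA => ?; exists (t * a) => //; apply: (loc_nmaxM locP).
have /regY[Q] :
    ideal_ext loc I (Y * loc (b * g) - (loc h * loc a) * X).
  have := ext _ Iygh; congr ideal_ext.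
  by rewrite rmorphB !rmorphM /= -aX -bY; ring.
have [c [q [mc cQ]]] := loc_frac locP Q.
move=> /(ideal_genMl (loc (c * a))).
have -> : loc (c * a) * (loc (b * g) - Q * X) = loc (c * a * b * g - q * x).
  by rewrite rmorphB !rmorphM /= -cQ -aX; ring.
move=> /(ideal_contr_locP _ II)[t mt It].
exists (t * (c * a * b)); first by do ?apply: (loc_nmaxM locP).
exists (t * q); move: It; congr I; ring.
Qed.

End LocalDepth.

Section PolynomialLocalization.
Variables (K : fieldType) (n : nat).
Local Notation S := {mpoly K[n]}.
Local Notation m := (@max_ideal K n).
Local Notation loc := (@to_loc K n).
Implicit Types (f g t : S).

Lemma to_locB : {morph loc : f g / f - g}.
Proof. by move=> f g; apply: val_inj; rewrite rmorphB /= tofracB. Qed.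

Lemma to_locM : {morph loc : f g / f * g}.
Proof. by move=> f g; apply: val_inj; rewrite rmorphM /= tofracM. Qed.

Lemma to_loc1 : loc 1 = 1.
Proof. by apply: val_inj; rewrite rmorph1 /= tofrac1. Qed.

HB.instance Definition _ := GRing.isZmodMorphism.Build S (loc_ring K n) loc to_locB.
HB.instance Definition _ :=
  GRing.isMonoidMorphism.Build S (loc_ring K n) loc (to_loc1, to_locM).

Lemma to_loc_inj : injective loc.
Proof. by move=> f g /(congr1 val) /= /eqP; rewrite tofrac_eq => /eqP. Qed.

Lemma to_loc_unit t : ~ m t -> exists u, loc t * u = 1.
Proof.
move=> mt; have u_loc : (tofrac t)^-1 \in loc_pred (K := K) (n := n).
  by apply/asboolP; exists 1, t; split=> //; rewrite tofrac1 div1r.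
exists (LocRing u_loc); apply: val_inj.
by rewrite rmorphM rmorph1 /= divff // notin_max_ideal_neq0.
Qed.

Lemma to_loc_frac (h : loc_ring K n) : exists t f, ~ m t /\ loc t * h = loc f.
Proof.
have /asboolP[f [t [mt hE]]] := loc_valP h; exists t, f; split=> //.
apply: val_inj; rewrite rmorphM /= hE mulrC divfK //.
exact: notin_max_ideal_neq0.
Qed.

Lemma to_loc_localization : localization_at m loc.
Proof.
split.
- exact: ideal_gen_is_ideal.
- exact: notin_max_ideal1.
- exact: notin_max_idealM.
- exact: to_loc_inj.
- exact: to_loc_unit.
- exact: to_loc_frac.
Qed.

End PolynomialLocalization.

(** * The squares of the facet primes *)

Section FacetPrimes.
Variables (K : fieldType) (n : nat).
Local Notation S := {mpoly K[n]}.
Implicit Types (F : {set 'I_n}) (f g : S) (m : 'X_{1..n}).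

Definition weight F m : nat := (\sum_(i | i \notin F) m i)%N.

Lemma weightD F m m' : weight F (m + m')%MM = (weight F m + weight F m')%N.
Proof. by rewrite -big_split; apply: eq_bigr => i _; rewrite mnmDE. Qed.

Lemma weight1 F i : weight F U_(i)%MM = (i \notin F).
Proof.
rewrite /weight; under eq_bigr do rewrite mnm1E.
have [iF|iF] := boolP (i \notin F).
  by rewrite (bigD1 i) //= eqxx big1 // => j /andP[_ /negPf nji]; rewrite eq_sym nji.
by rewrite big1 // => j jF; case: eqP jF => // <-; rewrite (negPf iF).
Qed.

Lemma weight_gt0P F m :
  reflect (exists2 i, i \notin F & (0 < m i)%N) (0 < weight F m)%N.
Proof.
rewrite lt0n sum_nat_eq0 negb_forall.
apply: (iffP existsP) => [[i]|[i iF mi]].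
  by rewrite negb_imply -lt0n => /andP[]; exists i.
by exists i; rewrite negb_imply iF -lt0n.
Qed.

Lemma mnm_subU m i : (0 < m i)%N -> m = (m - U_(i) + U_(i))%MM.
Proof.
move=> mi; rewrite submK //; apply/mnm_lepP => j; rewrite mnm1E.
by case: eqP => // <-.
Qed.

(** The component of [f] of degree [k] for the grading in which the variables
outside [F] have degree 1 and the others degree 0, read off from the substitution
[X_i -> X_i T] for [i] outside [F].  As that is a ring morphism, the product
formulas below are those for the coefficients of a product of polynomials in [T].
The lock keeps unification from unfolding the substitution. *)
Definition weight_part F (k : nat) f : S :=
  locked (mmap (polyC \o @mpolyC n K)
               (fun i => ('X_i)%:P * 'X^(i \notin F)) f)`_k.

Lemma weight_partE F k f : weight_part F k f =
  (mmap (polyC \o @mpolyC n K)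
        (fun i => ('X_i)%:P * 'X^(i \notin F)) f)`_k.
Proof. by rewrite /weight_part -lock. Qed.

Lemma weight_partD F k : {morph weight_part F k : f g / f + g}.
Proof. by move=> f g; rewrite !weight_partE mmapD coefD. Qed.

Lemma weight_part0M F f g :
  weight_part F 0 (f * g) = weight_part F 0 f * weight_part F 0 g.
Proof. by rewrite !weight_partE rmorphM coef0M. Qed.

Lemma weight_part1M F f g :
  weight_part F 1 (f * g) =
  weight_part F 0 f * weight_part F 1 g + weight_part F 1 f * weight_part F 0 g.
Proof. by rewrite !weight_partE rmorphM coefM !big_ord_recl big_ord0 addr0. Qed.

Lemma weight_part0 F k : weight_part F k 0 = 0.
Proof. by rewrite !weight_partE mmap0 coef0. Qed.

Lemma weight_partZX F k c m :
  weight_part F k (c *: 'X_[m]) = if weight F m == k then c *: 'X_[m] else 0.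
Proof.
rewrite !weight_partE mmapZ mmapX /mmap1; under eq_bigr do rewrite exprMn -exprM.
rewrite big_split /= prodrXr.
have -> : (\sum_i (i \notin F) * m i)%N = weight F m.
  rewrite /weight [RHS]big_mkcond.
  by apply: eq_bigr => i _; case: (i \notin F); rewrite ?mul1n.
under eq_bigr do rewrite -rmorphXn; rewrite -rmorph_prod -mpolyXE_id.
rewrite !coefCM coefXn eq_sym mul_mpolyC.
by case: eqP; rewrite ?mulr1 ?mulr0 ?scaler0.
Qed.

Lemma mcoeff_weight_part F f k m :
  (weight_part F k f)@_m = if weight F m == k then f@_m else 0.
Proof.
elim/mpolyind: f => [|c m' f _ _ IHf].
  by rewrite weight_part0 mcoeff0 if_same.
rewrite weight_partD weight_partZX !mcoeffD IHf mcoeffZ mcoeffX.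
have [<-|ne] := eqVneq m' m.
  by case: ifP; rewrite ?mcoeffZ ?mcoeffX ?eqxx ?mcoeff0 ?add0r.
rewrite mulr0 add0r; case: ifP; rewrite ?mcoeff0 ?add0r //.
by rewrite mcoeffZ mcoeffX (negPf ne) mulr0 add0r.
Qed.

Lemma facet_prime_vanish F f (v : 'I_n -> K) :
  (forall j, j \notin F -> v j = 0) -> facet_prime F f -> f.@[v] = 0.
Proof.
move=> v0; apply: (ideal_gen_min (J := fun f => f.@[v] = 0)) => [|_ [i iF ->]].
  split=> [|g h g0 h0|a g g0]; rewrite ?meval0 //.
    by rewrite mevalD g0 h0 addr0.
  by rewrite mevalM g0 mulr0.
by rewrite mevalXU v0 // -in_setC.
Qed.

Lemma facet_primeP F f : facet_prime F f <-> weight_part F 0 f = 0.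
Proof.
rewrite /facet_prime var_idealP; split=> [Pf|f0 m mf].
  apply/mpolyP => m; rewrite mcoeff_weight_part mcoeff0; case: eqP => // w0.
  apply/eqP; rewrite mcoeff_eq0; apply/negP => /Pf[i]; rewrite inE => iF mi.
  suff : (0 < weight F m)%N by rewrite w0.
  by apply/weight_gt0P; exists i.
have /weight_gt0P[i iF mi] : (0 < weight F m)%N.
  rewrite lt0n; apply: contraTneq mf => w0; rewrite -mcoeff_eq0.
  by have := mcoeff_weight_part F f 0 m; rewrite f0 mcoeff0 w0 eqxx => <-.
by exists i; rewrite ?inE.
Qed.

Lemma sq_facet_prime_part F f :
  ideal_sq (facet_prime F) f <-> weight_part F 0 f = 0 /\ weight_part F 1 f = 0.
Proof.
split.
  pose E f := weight_part F 0 f = 0 /\ weight_part F 1 f = 0.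
  apply: (ideal_gen_min (J := E)); rewrite {}/E.
    split=> [|g h [g0 g1] [h0 h1]|a g [g0 g1]].
    - by rewrite !weight_part0.
    - by rewrite !weight_partD g0 g1 h0 h1 addr0.
    - by rewrite weight_part0M weight_part1M g0 g1 !mulr0 addr0.
  move=> _ [a [b [/facet_primeP a0 /facet_primeP b0 ->]]].
  by rewrite weight_part0M weight_part1M a0 b0 !mulr0 !mul0r addr0.
move=> [f0 f1]; rewrite [f]mpolyE big_seq.
have [Q0 QD QM] : is_ideal (ideal_sq (facet_prime F : S -> Prop)).
  exact: ideal_gen_is_ideal.
apply: big_ind => // m mf; rewrite -mul_mpolyC; apply: (QM).
have nz k : weight_part F k f = 0 -> weight F m != k.
  move=> fk; apply: contraTneq mf => wk; rewrite -mcoeff_eq0.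
  by have := mcoeff_weight_part F f k m; rewrite fk mcoeff0 wk eqxx => <-.
have {nz} : (1 < weight F m)%N by case: (weight F m) (nz _ f0) (nz _ f1) => [|[]].
move=> w2; have /weight_gt0P[i iF mi] : (0 < weight F m)%N by apply: ltnW.
move: w2; rewrite (mnm_subU mi) weightD weight1 iF addn1 ltnS.
move: (m - _)%MM => m' /weight_gt0P[j jF mj]; rewrite (mnm_subU mj) !mpolyXD -mulrA.
have P k : k \notin F -> facet_prime F ('X_k : S).
  by move=> kF; apply: ideal_gen_mem; exists k; rewrite ?inE.
by apply/QM/ideal_gen_mem; exists 'X_j, 'X_i; split=> //; apply: P.
Qed.

Lemma sq_facet_primeP F f :
  ideal_sq (facet_prime F) f <-> forall m, (weight F m <= 1)%N -> f@_m = 0.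
Proof.
rewrite sq_facet_prime_part; split=> [[f0 f1] m|f0].
  have := mcoeff_weight_part F f (weight F m) m; rewrite eqxx.
  by case: (weight F m) => [|[|//]]; rewrite ?f0 ?f1 mcoeff0.
by split; apply/mpolyP=> m; rewrite mcoeff_weight_part mcoeff0;
  case: eqP => // wm; apply: f0; rewrite wm.
Qed.

(** In terms of the components [f_k], membership in [P_F] means [f_0 = 0] and
membership in [P_F^2] means [f_0 = f_1 = 0]; the ring is a domain, so [f_0] can
be cancelled first from [f_0 g_0 = 0] and then from [f_0 g_1 = 0]. *)
Lemma sq_facet_prime_primary F f g : ~ facet_prime F f ->
  ideal_sq (facet_prime F) (f * g) -> ideal_sq (facet_prime F) g.
Proof.
rewrite facet_primeP !sq_facet_prime_part weight_part0M weight_part1M.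
move: (weight_part F 0 f) (weight_part F 1 f) => a a1.
move: (weight_part F 0 g) (weight_part F 1 g) => b b1 /eqP a_neq0 [/eqP].
rewrite mulf_eq0 (negPf a_neq0) /= => /eqP->; rewrite mulr0 addr0 => /eqP.
by rewrite mulf_eq0 (negPf a_neq0) /= => /eqP->.
Qed.

End FacetPrimes.

(** * Facets carrying a monomial, and graphs of diameter 2 *)

Section Weights.
Variable n : nat.
Implicit Types (F G : {set 'I_n}) (m : 'X_{1..n}).

Lemma leq_weight F m i : i \notin F -> (m i <= weight F m)%N.
Proof. by move=> iF; rewrite /weight (bigD1 i) //= leq_addr. Qed.

Lemma weightC F m : (weight F m + weight (~: F) m)%N = mdeg m.
Proof.
rewrite mdegE (bigID (fun i => i \notin F)) /=; congr addn.
by apply: eq_bigl => i; rewrite inE.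
Qed.

Lemma weight_subset F G m : F \subset G -> (weight G m <= weight F m)%N.
Proof.
move=> /subsetP FG; rewrite /weight !(big_mkcond (fun i => i \notin _)).
apply: leq_sum => i _; have := FG i.
by case: (i \in F) (i \in G) => [] [] // /(_ isT).
Qed.

(** As [m] has exponent sum at most 1 on [F], one vertex [u] of [F] carries all of
it; every [H] through [u] then misses no more of [m] than [F] does. *)
Lemma weight_concentrated F m i0 : i0 \in F ->
    (weight F m <= 1)%N -> (weight (~: F) m <= 1)%N ->
  exists2 u, u \in F & forall H : {set 'I_n}, u \in H -> (weight H m <= 1)%N.
Proof.
move=> Fi0 wF wFC.
have [u Fu mu] : exists2 u, u \in F & m u = weight (~: F) m.
  have [w0|] := posnP (weight (~: F) m).
    exists i0 => //; apply/eqP; rewrite w0 -leqn0 -w0; apply: leq_weight.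
    by rewrite inE Fi0.
  move=> /weight_gt0P[u]; rewrite inE negbK => Fu mu; exists u => //.
  apply/eqP; rewrite eqn_leq (leq_trans wFC mu) andbT; apply: leq_weight.
  by rewrite inE Fu.
exists u => // H Hu; apply: leq_trans wF.
rewrite -(leq_add2r (m u)) {2}mu weightC -(weightC H) leq_add2l.
by apply: leq_weight; rewrite inE Hu.
Qed.

End Weights.

Section Complexes.
Variables (n : nat) (D : {set {set 'I_n}}).
Hypothesis hD : simplicial_complex D.
Implicit Types (F G H : {set 'I_n}) (u v i j k : 'I_n).

Lemma face_subset F G : F \in D -> G \subset F -> G \in D.
Proof. by case: hD => _ + _; apply. Qed.

Lemma facet_face F : facet D F -> F \in D.
Proof. by move=> /maxsetP[]. Qed.

Lemma face_in_facet F : F \in D -> exists2 G, facet D G & F \subset G.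
Proof. by move=> DF; have [G] := maxset_exists (P := mem D) DF; exists G. Qed.

Lemma edge_facet i j F : facet D F -> i \in F -> j \in F -> [set i; j] \in D.
Proof.
move=> /facet_face/face_subset DF Fi Fj; apply: DF.
by apply/subsetP => k /set2P[] ->.
Qed.

Lemma edge_loop i : [set i; i] \in D.
Proof. by rewrite setUid; case: hD. Qed.

(** Loops are faces, so that equal and adjacent vertices also have such a [k]:
this is diameter at most 2. *)
Definition close_vertices : Prop :=
  forall u v, exists k, [set u; k] \in D /\ [set k; v] \in D.

Lemma skeleton1_adjE u v :
  skeleton1_adj D u v = (u != v) && ([set u; v] \in D).
Proof.
rewrite /skeleton1_adj inE /face_dim cards2.
by case: (u != v); rewrite //= andbT.
Qed.

Lemma diameter_le2P :
  ext_leq (diameter (skeleton1_adj D)) 2 <-> close_vertices.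
Proof.
have adjD u v : skeleton1_adj D u v -> [set u; v] \in D.
  by rewrite skeleton1_adjE => /andP[].
rewrite /diameter; split.
  case: ifP => //= /forallP conn le2 u v.
  have [/existsP[p /andP[up /eqP pv]] _] := distanceP (forallP (conn u) v).
  have : (size p <= 2)%N.
    rewrite size_tuple; apply: leq_trans le2.
    pose d := distance (skeleton1_adj D).
    apply: (@leq_trans (\max_w d u w)%N); first exact: (leq_bigmax (F := d u)).
    exact: (leq_bigmax (F := fun a => \max_w d a w)%N).
  case: (tval p) up pv => [_ /= -> _|a [|b []//]] /=.
  - by exists v; split; apply: edge_loop.
  - by rewrite andbT => /adjD ua <- _; exists a; split=> //; apply: edge_loop.
  - by move=> /and3P[/adjD ua /adjD ab _] <- _; exists a.
move=> close.
have short u v : exists2 p, path (skeleton1_adj D) u p /\ last u p = v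
                          & (size p <= 2)%N.
  have [k [uk kv]] := close u v.
  have [uk_eq|nuk] := eqVneq u k; have [kv_eq|nkv] := eqVneq k v.
  - by exists [::]; rewrite //= uk_eq.
  - by exists [:: v]; rewrite //= skeleton1_adjE uk_eq nkv kv.
  - by exists [:: v]; rewrite //= skeleton1_adjE -kv_eq nuk uk.
  - by exists [:: k; v]; rewrite //= !skeleton1_adjE nuk uk nkv kv.
have conn u v : connect (skeleton1_adj D) u v.
  by have [p [up pv] _] := short u v; apply/connectP; exists p.
rewrite ifT; last by apply/forallP => u; apply/forallP => v.
rewrite /=; apply/bigmax_leqP => u _; apply/bigmax_leqP => v _.
have [p [up pv] p2] := short u v.
by apply: leq_trans p2; case: (distanceP (conn u v)) => _; apply.
Qed.

Hypothesis close : close_vertices.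

(** A facet inside [{i}] would make [i] an isolated vertex, at infinite distance
from the other vertices, which exist because the dimension is at least 1. *)
Lemma facet_second_vertex F i : (1 <= complex_dim D)%R -> facet D F ->
  exists2 j, j \in F & j != i.
Proof.
move=> dimD facetF; have [j|F0] := pickP [pred j in F | j != i].
  by move=> /andP[]; exists j.
have {}F0 j : j \in F -> j = i.
  by move=> Fj; have /= := F0 j; rewrite Fj /= => /negbFE/eqP.
have [G DG cardG] : exists2 G, G \in D & (1 < #|G|)%N.
  have [G /andP[]|G0] := pickP [pred G in D | (1 < #|G|)%N]; first by exists G.
  suff : (\max_(G in D) #|G| <= 1)%N.
    by move: dimD; rewrite /complex_dim; case: (\max_(G in D) _)%N => [|[]].
  by apply/bigmax_leqP => G DG; have /= := G0 G; rewrite DG /= ltnNge => /negbFE.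
have [j Gj nji] : exists2 j, j \in G & j != i.
  have [a [b [Ga Gb nab]]] := card_gt1P cardG.
  by have [ai|] := eqVneq a i; [exists b; rewrite // -ai eq_sym | exists a].
have maxF H : H \in D -> F \subset H -> H = F by case/maxsetP: facetF => _; apply.
have Fsub k : F \subset [set i; k] by apply/subsetP => l /F0->; rewrite set21.
have [k [ik kj]] := close i j.
have Fk : k \in F by rewrite -(maxF _ ik (Fsub k)) set22.
rewrite (F0 _ Fk) in kj; have : j \in F by rewrite -(maxF _ kj (Fsub j)) set22.
by move=> /F0 ji; rewrite ji eqxx in nji.
Qed.

(** Facets that meet are linked by a common vertex.  If [F] and [G] are disjoint,
all facets through a suitable [u] in [F], or through a suitable [v] in [G], satisfy
the weight condition, and facets containing [{u, k}] and [{k, v}] for a common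
neighbour [k] form a chain from [F] to [G]. *)
Lemma facet_weight_connected (T : Type) (c : 'I_n -> T) (m : 'X_{1..n}) :
    (forall F i j, facet D F -> (weight F m <= 1)%N ->
       i \in F -> j \in F -> c i = c j) ->
  forall F G i j, facet D F -> facet D G -> (weight F m <= 1)%N ->
    (weight G m <= 1)%N -> i \in F -> j \in G -> c i = c j.
Proof.
move=> cF F G i j facetF facetG wF wG Fi Gj.
have [FG|/pred0Pn[k /andP[Fk Gk]]] := boolP [disjoint F & G]; last first.
  exact: etrans (cF F i k _ _ _ _) (cF G k j _ _ _ _).
have small H1 H2 : [disjoint H1 & H2] -> (weight H2 m <= 1)%N ->
    (weight (~: H1) m <= 1)%N.
  move=> H12; apply: leq_trans; apply: weight_subset.
  by rewrite -disjoints_subset disjoint_sym.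
have [u Fu smallu] := weight_concentrated Fi wF (small _ _ FG wG).
have [v Gv smallv] : exists2 v, v \in G &
    forall H : {set 'I_n}, v \in H -> (weight H m <= 1)%N.
  by apply: weight_concentrated Gj wG (small _ _ _ wF); rewrite disjoint_sym.
have [k [/face_in_facet[H1 facetH1 H1uk] /face_in_facet[H2 facetH2 H2kv]]] :=
  close u v.
have H1u : u \in H1 by rewrite (subsetP H1uk) // set21.
have H2v : v \in H2 by rewrite (subsetP H2kv) // set22.
have H1k : k \in H1 by rewrite (subsetP H1uk) // set22.
have H2k : k \in H2 by rewrite (subsetP H2kv) // set21.
rewrite (cF F i u) // (cF H1 u k) ?smallu //.
by rewrite (cF H2 k v) ?smallv // (cF G v j).
Qed.

End Complexes.

(** * The second symbolic power *)

Lemma sum_delta (R : nzRingType) (T : finType) (P : pred T) (k : T) :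
  \sum_(j | P j) (j == k)%:R = (P k)%:R :> R.
Proof.
rewrite big_mkcond (bigD1 k) //= eqxx big1 ?addr0; first by case: (P k).
by move=> j /negPf->; rewrite if_same.
Qed.

Section SymbolicSquare.
Variables (K : fieldType) (n : nat) (D : {set {set 'I_n}}).
Hypothesis hD : simplicial_complex D.
Local Notation S := {mpoly K[n]}.
Local Notation I := (@sr_symbolic_square K n D).
Local Notation max := (@max_ideal K n).
Implicit Types (F G H : {set 'I_n}) (i j k u v : 'I_n) (f g h : S).
Implicit Types (m : 'X_{1..n}).

Lemma symbolic_squareP f :
  I f <-> forall F, facet D F -> forall m, (weight F m <= 1)%N -> f@_m = 0.
Proof.
by split=> If F facetF; [move=> m; move: m; apply/sq_facet_primeP|
  apply/sq_facet_primeP]; apply: If.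
Qed.

Lemma symbolic_square_is_ideal : is_ideal I.
Proof.
split=> [F facetF|f g If Ig F facetF|a f If F facetF].
- exact: ideal_gen0.
- by apply: ideal_genD; [apply: If | apply: Ig].
- by apply: ideal_genMl; apply: If.
Qed.

Let II := symbolic_square_is_ideal.

Lemma symbolic_square_max f : I f -> max f.
Proof.
move=> /symbolic_squareP If; rewrite max_idealP.
have D0 : set0 \in D.
  by case: hD => /set0Pn[F DF] _ _; apply: (face_subset hD DF); exact: sub0set.
have [F facetF _] := face_in_facet D0.
by apply: (If F facetF); rewrite /weight big1 // => i _; rewrite mnm0E.
Qed.

Lemma var_ideal_split (N : {set 'I_n}) f : max f ->
  exists f1 f2, [/\ var_ideal N f1, var_ideal (~: N) f2 & f = f1 + f2].
Proof.
pose E f := exists f1 f2, [/\ var_ideal N f1, var_ideal (~: N) f2 & f = f1 + f2].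
apply: (ideal_gen_min (J := E)) => [|_ [i _ ->]].
  split.
  - by exists 0, 0; split; rewrite ?addr0 //; exact: ideal_gen0.
  - move=> _ _ [f1 [f2 [Nf1 Nf2 ->]]] [g1 [g2 [Ng1 Ng2 ->]]].
    by exists (f1 + g1), (f2 + g2); split; [exact: ideal_genD .. | rewrite addrACA].
  - move=> a ? [f1 [f2 [Nf1 Nf2 ->]]].
    by exists (a * f1), (a * f2); split; [exact: ideal_genMl .. | rewrite mulrDr].
have [Ni|Ni] := boolP (i \in N).
  exists 'X_i, 0; rewrite addr0; split=> //; last exact: ideal_gen0.
  by apply: ideal_gen_mem; exists i.
exists 0, 'X_i; rewrite add0r; split=> //; first exact: ideal_gen0.
by apply: ideal_gen_mem; exists i; rewrite // inE.
Qed.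

(** * Vertices at distance greater than 2 exclude depth 2 *)

Section Separation.
Variables u v : 'I_n.
Hypothesis far : forall k, [set u; k] \in D -> [set k; v] \in D -> False.
Let N := [set k | [set u; k] \in D].

(** A facet contains at most one of [u] and [v].  If it contains [u] it misses [v]
and [l]; if it contains [v] it misses [u] and [k]; otherwise it misses [u] and
[v].  So every facet misses at least two of the four factors. *)
Lemma far_product a b :
  var_ideal N a -> var_ideal (~: N) b -> I ('X_u * 'X_v * (a * b)).
Proof.
have [I0 ID IM] := II => Na Nb.
apply: (ideal_gen_min (J := fun a => I ('X_u * 'X_v * (a * b)))) Na.
  split=> [|f g If Ig|c f If].
  - by rewrite mul0r mulr0.
  - by rewrite mulrDl mulrDr; apply: ID.
  - by have := IM c _ If; congr I; ring.
move=> _ [k Nk ->].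
apply: (ideal_gen_min (J := fun b => I ('X_u * 'X_v * ('X_k * b)))) Nb.
  split=> [|f g If Ig|c f If].
  - by rewrite !mulr0.
  - by rewrite !mulrDr; apply: ID.
  - by have := IM c _ If; congr I; ring.
move=> _ [l Nl ->]; apply/symbolic_squareP => F facetF m wm.
rewrite -!mpolyXD mcoeffX; case: eqP => // mE; move: wm.
rewrite -mE !weightD !weight1 leqNgt => /negP[].
move: Nk Nl; rewrite !inE => uk /negP ul.
have edge := edge_facet hD facetF.
have [uF|uF] := boolP (u \in F); have [vF|vF] := boolP (v \in F);
  have [kF|kF] := boolP (k \in F); have [lF|lF] := boolP (l \in F) => //;
  by [case: (ul (edge _ _ uF lF)) | case: (far (edge _ _ uF vF) (edge_loop hD v))
     | case: (far uk (edge _ _ kF vF))].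
Qed.

(** With [x = x1 + x2] and [y = y1 + y2] split along [N], the elements
[X_u X_v x1] and [X_u X_v y1] satisfy [y (X_u X_v x1) = x (X_u X_v y1)] modulo the
ideal, whence [X_u X_v x1 = q x] up to a denominator.  Multiplying by [X_u] and
by [X_v] and cancelling [x] gives [X_u q = X_u^2 X_v] and [X_v q = 0]. *)
Lemma far_not_regular x y : max x -> max y ->
    (forall g, I (x * g) -> exists2 t, ~ max t & I (t * g)) ->
    (forall g h, I (y * g - h * x) ->
      exists2 t, ~ max t & exists q, I (t * g - q * x)) ->
  False.
Proof.
have [I0 ID IM] := II => mx my regx regy.
have Nu : var_ideal N ('X_u : S).
  by apply: ideal_gen_mem; exists u; rewrite // inE edge_loop.
have Nv : var_ideal (~: N) ('X_v : S).
  apply: ideal_gen_mem; exists v; rewrite // !inE; apply/negP => uv.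
  exact: far uv (edge_loop hD v).
have [x1 [x2 [Nx1 Nx2 xE]]] := var_ideal_split N mx.
have [y1 [y2 [Ny1 Ny2 yE]]] := var_ideal_split N my.
have [t mt [q Iq]] : exists2 t, ~ max t &
    exists q, I (t * ('X_u * 'X_v * x1) - q * x).
  apply: (regy _ ('X_u * 'X_v * y1)).
  have := idealB II (far_product Nx1 Ny2) (far_product Ny1 Nx2).
  by congr I; rewrite xE yE; ring.
have [t1 mt1 It1] : exists2 t1, ~ max t1 &
    I (t1 * (t * ('X_u * 'X_u * 'X_v) - q * 'X_u)).
  apply: regx; have := ID _ _ (IM 'X_u _ Iq) (IM t _ (far_product Nu Nx2)).
  by congr I; rewrite xE; ring.
have [t2 mt2 It2] : exists2 t2, ~ max t2 & I (t2 * (q * 'X_v)).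
  apply: regx; have := idealB II (IM t _ (far_product Nx1 Nv)) (IM 'X_v _ Iq).
  by congr I; ring.
pose T := t1 * t2 * t; pose P := t1 * t2 * q.
have IT : I ((T * 'X_[U_(u) + U_(v)] - P) * 'X_u).
  by have := IM t2 _ It1; congr I; rewrite /T /P mpolyXD; ring.
have IP : I (P * 'X_v).
  by have := IM t1 _ It2; congr I; rewrite /P; ring.
(* X_u X_v X_w has weight at most 1 for any facet through w, so it occurs in no
   element of the ideal. *)
have coef0 f w : u = w \/ v = w -> I (f * 'X_w) -> f@_(U_(u) + U_(v)) = 0.
  move=> uvw /symbolic_squareP If; rewrite -(mcoeffMX f U_(w)).
  have [_ _ /(_ w)/face_in_facet[F facetF]] := hD; rewrite sub1set => Fw.
  apply: (If F facetF); rewrite !weightD !weight1 Fw.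
  by case: uvw => ->; rewrite Fw ?addn0 ?add0n leq_b1.
have := coef0 _ v (or_intror erefl) IP.
have := coef0 _ u (or_introl erefl) IT.
rewrite mcoeffB -[X in _@_X]add0m addmC mcoeffMX => /eqP.
rewrite subr_eq0 => /eqP TP P0.
have : ~ max T by do ?apply: notin_max_idealM.
by case; rewrite max_idealP TP P0.
Qed.

End Separation.

(** * The regular sequence e1, e2 *)

Definition vertex_sum : S := \sum_(i < n) 'X_i.
Definition pair_sum : S := \sum_(i < n) 'X_i * \sum_(j < n | (i < j)%N) 'X_j.
Local Notation e1 := vertex_sum.
Local Notation e2 := pair_sum.

Lemma vertex_sum_max : max e1.
Proof.
rewrite max_idealP raddf_sum big1 //= => i _.
by apply/max_idealP/ideal_gen_mem; exists i.
Qed.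

Lemma pair_sum_max : max e2.
Proof.
rewrite max_idealP raddf_sum big1 //= => i _; apply/max_idealP.
by rewrite mulrC; apply/ideal_genMl/ideal_gen_mem; exists i.
Qed.

Lemma meval_vertex_sum (a : 'I_n -> K) : e1.@[a] = \sum_i a i.
Proof. by rewrite rmorph_sum; apply: eq_bigr => i _; rewrite /= mevalXU. Qed.

Lemma meval_pair_sum (a : 'I_n -> K) :
  e2.@[a] = \sum_(i < n) a i * \sum_(j < n | (i < j)%N) a j.
Proof.
rewrite rmorph_sum; apply: eq_bigr => i _; rewrite /= mevalM mevalXU rmorph_sum.
by congr (_ * _); apply: eq_bigr => j _; rewrite /= mevalXU.
Qed.

Lemma not_facet_prime F k f : k \in F -> f.@[fun j => (j == k)%:R] != 0 ->
  ~ facet_prime F f.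
Proof.
move=> Fk /eqP fk /(facet_prime_vanish (v := fun j => (j == k)%:R)) f0.
by case: fk; apply: f0 => j jF; case: eqP Fk jF => // <- ->.
Qed.

Lemma vertex_sum_notin F k : k \in F -> ~ facet_prime F e1.
Proof.
move=> Fk; apply: (not_facet_prime Fk).
by rewrite meval_vertex_sum (sum_delta _ xpredT) oner_eq0.
Qed.

Lemma sq_var_notin F k : k \in F -> ~ facet_prime F ('X_k ^+ 2 : S).
Proof.
move=> Fk; apply: (not_facet_prime Fk).
by rewrite mevalM mevalXU eqxx mulr1 oner_eq0.
Qed.

(** The substitution of the remaining variables' negated sum for [X_i]; it is
the identity modulo [e1], and represents the passage to the quotient by [e1]. *)
Definition eliminate i (f : S) : S :=
  f \mPo [tuple ('X_j - (j == i)%:R * e1) | j < n].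

Fact eliminate_is_zmod_morphism i : zmod_morphism (eliminate i).
Proof. exact: comp_mpolyB. Qed.

Fact eliminate_is_monoid_morphism i : monoid_morphism (eliminate i).
Proof.
split; first exact: comp_mpoly1.
exact: (comp_mpoly_is_multiplicative [tuple 'X_j - (j == i)%:R * e1 | j < n]).1.
Qed.

HB.instance Definition _ i :=
  GRing.isZmodMorphism.Build S S (eliminate i) (eliminate_is_zmod_morphism i).
HB.instance Definition _ i :=
  GRing.isMonoidMorphism.Build S S (eliminate i) (eliminate_is_monoid_morphism i).

Lemma eliminateX i j : eliminate i 'X_j = 'X_j - (j == i)%:R * e1.
Proof. by rewrite /eliminate comp_mpolyXU -tnth_nth tnth_mktuple. Qed.

Lemma eliminate_vertex_sum i : eliminate i e1 = 0.
Proof.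
rewrite /vertex_sum raddf_sum /=.
under eq_bigr do rewrite eliminateX.
by rewrite sumrB -mulr_suml (sum_delta _ xpredT) mul1r subrr.
Qed.

Lemma eliminate_mod i f : exists q, f = eliminate i f + q * e1.
Proof.
elim/mpolyind: f => [|c m f _ _ [q fE]].
  by exists 0; rewrite rmorph0 mul0r addr0.
suff [r mE] : exists r, 'X_[m] = eliminate i 'X_[m] + r * e1.
  exists (c%:MP * r + q).
  rewrite {1}fE {1}mE -!mul_mpolyC rmorphD rmorphM /= [eliminate i c%:MP]comp_mpolyC.
  by ring.
rewrite mpolyXE_id.
apply: (big_ind (fun g => exists r, g = eliminate i g + r * e1)).
- by exists 0; rewrite rmorph1 mul0r addr0.
- move=> g h [r {1}->] [r' {1}->]; rewrite rmorphM.
  by exists (r * (eliminate i h + r' * e1) + eliminate i g * r'); ring.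
move=> j _; elim: (m j) => [|k [r IHk]].
  by exists 0; rewrite expr0 rmorph1 mul0r addr0.
rewrite !exprS rmorphM /= {1}IHk eliminateX.
by exists ('X_j * r + (j == i)%:R * eliminate i ('X_j ^+ k)); ring.
Qed.

Lemma eliminate_facet_prime i F f : i \in F ->
  facet_prime F f -> facet_prime F (eliminate i f).
Proof.
move=> Fi; apply: (ideal_gen_min (J := fun f => facet_prime F (eliminate i f))).
  exact/preim_is_ideal/ideal_gen_is_ideal.
move=> _ [j jF ->]; rewrite eliminateX.
have /negPf-> : j != i by apply: contraTneq jF => ->; rewrite inE Fi.
by rewrite mul0r subr0; apply: ideal_gen_mem; exists j.
Qed.

Lemma eliminate_sq_facet_prime i F f : i \in F ->
  ideal_sq (facet_prime F) f -> ideal_sq (facet_prime F) (eliminate i f).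
Proof.
move=> Fi.
apply: (ideal_gen_min (J := fun f => ideal_sq (facet_prime F) (eliminate i f))).
  exact/preim_is_ideal/ideal_gen_is_ideal.
move=> _ [a [b [Pa Pb ->]]]; rewrite rmorphM; apply: ideal_gen_mem.
by exists (eliminate i a), (eliminate i b); split=> //; apply: eliminate_facet_prime.
Qed.

(** At the point with only nonzero coordinate [x_k = 1], eliminating [X_i] amounts
to evaluating [e2] at [x_k = 1], [x_i = -1], where its value is [-1].  This
needs a second vertex [k] in each facet through [i]. *)
Lemma eliminate_pair_sum_notin i k F : k \in F -> k != i ->
  ~ facet_prime F (eliminate i e2).
Proof.
move=> Fk ki; apply: (not_facet_prime Fk).
rewrite /eliminate comp_mpoly_meval.
rewrite (meval_eq (v2 := fun j => (j == k)%:R - (j == i)%:R)); last first.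
  move=> j; rewrite tnth_mktuple mevalB mevalM mevalXU rmorph_nat.
  by rewrite meval_vertex_sum (sum_delta _ xpredT) mulr1.
rewrite meval_pair_sum.
under eq_bigr do rewrite sumrB !sum_delta mulrBl.
have pick (a : 'I_n -> K) l : \sum_j (j == l)%:R * a j = a l.
  rewrite (bigD1 l) //= eqxx mul1r big1 ?addr0 // => j /negPf->.
  by rewrite mul0r.
rewrite sumrB !pick !ltnn subr0 sub0r -opprD oppr_eq0.
by case: ltngtP ki => [||/val_inj->]; rewrite ?addr0 ?add0r ?oner_eq0 ?eqxx.
Qed.

Hypothesis dimD : (1 <= complex_dim D)%R.
Hypothesis close : close_vertices D.

Lemma facet_vertex F : facet D F -> exists i, i \in F.
Proof.
move=> facetF; apply/set0Pn; apply: contraTneq dimD => F0.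
rewrite /complex_dim.
have -> : (\max_(G in D) #|G| = 0)%N; last by [].
apply/eqP; rewrite -leqn0; apply/bigmax_leqP => G DG.
have /maxsetP[_ maxF] := facetF.
by rewrite leqn0 cards_eq0 -F0 (maxF G) // F0 sub0set.
Qed.

Lemma vertex_sum_regular f : I (e1 * f) -> I f.
Proof.
move=> If F facetF; have [k Fk] := facet_vertex facetF.
exact: sq_facet_prime_primary (vertex_sum_notin Fk) (If F facetF).
Qed.

Lemma sq_vars_saturated f : (forall i, I ('X_i ^+ 2 * f)) -> I f.
Proof.
move=> If F facetF; have [k Fk] := facet_vertex facetF.
exact: sq_facet_prime_primary (sq_var_notin Fk) (If k F facetF).
Qed.

(** The factor [X_i^2] lies in [P_F^2] for the facets [F] that avoid [i]; for the
others, [P_F^2] is stable under the elimination of [X_i], which kills [e1] and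
leaves [e2] cancellable. *)
Lemma local_quotient f h i : I (e2 * f - h * e1) ->
  exists w, I ('X_i ^+ 2 * f - w * e1).
Proof.
move=> If; have [q fE] := eliminate_mod i f.
exists ('X_i ^+ 2 * q).
have -> : 'X_i ^+ 2 * f - 'X_i ^+ 2 * q * e1 = 'X_i ^+ 2 * eliminate i f.
  by rewrite {1}fE; ring.
move=> F facetF; have [Fi|Fi] := boolP (i \in F); last first.
  rewrite mulrC; apply: ideal_genMl; apply: ideal_gen_mem.
  by exists 'X_i, 'X_i; split=> //; apply: ideal_gen_mem; exists i; rewrite // inE.
apply: ideal_genMl.
have [k Fk ki] := facet_second_vertex close i dimD facetF.
apply: sq_facet_prime_primary (eliminate_pair_sum_notin Fk ki) _.
have := eliminate_sq_facet_prime Fi (If F facetF).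
by rewrite rmorphB !rmorphM /= eliminate_vertex_sum mulr0 subr0.
Qed.

Lemma mcoeff_mul_sqX f i m :
  (f * 'X_i ^+ 2)@_(m + U_(i) *+ 2) = f@_m.
Proof. by rewrite mpolyXn addmC mcoeffMX. Qed.

Lemma mcoeff_mul_sqX_small f i m : (m i < 2)%N -> (f * 'X_i ^+ 2)@_m = 0.
Proof.
move=> mi; apply/eqP; rewrite mcoeff_eq0 mpolyXn (perm_mem (msuppMX _ _)).
apply/mapP => -[m' _ mE]; move: mi; rewrite mE mnmDE mulmnE mnm1E eqxx.
by rewrite ltnNge leq_addr.
Qed.

Lemma weight_add_face F m i : i \in F ->
  weight F (m + U_(i) *+ 2)%MM = weight F m.
Proof.
by move=> Fi; rewrite mulmS mulm1n !weightD weight1 Fi !addn0.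
Qed.

(** The fractions [w_i / X_i^2] agree on overlaps; the coefficient of the glued
element at [m] is read off from any [w_i] such that [i] lies in a facet carrying
[m], and connectedness makes the choice of [i] immaterial.  The exponent 2 ensures
that a monomial divisible by [X_i^2] is carried only by facets through [i]. *)
Lemma local_quotients_glue (w : 'I_n -> S) :
    (forall i j, I ('X_i ^+ 2 * w j - 'X_j ^+ 2 * w i)) ->
  exists W, forall i, I ('X_i ^+ 2 * W - w i).
Proof.
move=> compat.
have compat_coef F i j m : facet D F -> (weight F m <= 1)%N ->
    (w j * 'X_i ^+ 2)@_m = (w i * 'X_j ^+ 2)@_m.
  move=> facetF wm; apply/eqP; rewrite -subr_eq0 -mcoeffB.
  have /symbolic_squareP/(_ F facetF m wm) := compat i j.
  by rewrite ![_ * w _]mulrC => ->.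
pose lives m i := [exists F : {set 'I_n},
  [&& facet D F, weight F m <= 1 & i \in F]%N].
pose c m := if [pick i | lives m i] is Some i
            then (w i)@_(m + U_(i) *+ 2) else 0.
have cE F i m : facet D F -> (weight F m <= 1)%N -> i \in F ->
    c m = (w i)@_(m + U_(i) *+ 2).
  move=> facetF wm Fi; rewrite /c; case: pickP => [j /existsP[G]|]; last first.
    by move=> /(_ i)/existsP[]; exists F; apply/and3P.
  move=> /and3P[facetG wGm Gj].
  apply: (facet_weight_connected close (m := m)
           (c := fun i => (w i)@_(m + U_(i) *+ 2)) _ facetG facetF) => //.
  move=> H k l facetH wHm Hk Hl.
  have := compat_coef H l k (m + U_(k) *+ 2 + U_(l) *+ 2)%MM facetH.
  rewrite mcoeff_mul_sqX -addmA (addmC (U_(k) *+ 2)%MM) addmA mcoeff_mul_sqX.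
  move=> -> //.
  by rewrite !weight_add_face.
(* The coefficients c vanish in large degree, so they define a polynomial. *)
pose B := (\max_i msize (w i))%N.
have c_big m : (B <= mdeg m)%N -> c m = 0.
  move=> Bm; rewrite /c; case: pickP => // i _; apply/eqP.
  rewrite mcoeff_eq0 msize_mdeg_ge // mdegD; apply: leq_trans (leq_addr _ _).
  exact: leq_trans (leq_bigmax i) Bm.
pose W : S := \sum_(m : 'X_{1..n < B}) c m *: 'X_[m].
have WE m : W@_m = c m.
  have [mB|Bm] := ltnP (mdeg m) B; first exact: mcoeff_mpoly.
  rewrite c_big // raddf_sum big1 //= => m' _; rewrite mcoeffZ mcoeffX.
  case: eqP => [m'E|]; last by rewrite mulr0.
  by have := bmdeg m'; rewrite m'E ltnNge Bm.
exists W => i; apply/symbolic_squareP => F facetF b wb.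
rewrite mulrC mcoeffB; apply/eqP; rewrite subr_eq0; apply/eqP.
have [bi|bi] := ltnP (b i) 2.
  rewrite mcoeff_mul_sqX_small //.
  (* No monomial with X_i in negative degree survives on the overlap with X_j. *)
  have [j Fj ji] := facet_second_vertex close i dimD facetF.
  rewrite -(mcoeff_mul_sqX (w i) j) -(compat_coef F) ?weight_add_face //.
  rewrite mcoeff_mul_sqX_small // mnmDE mulmnE mnm1E.
  by rewrite (negPf ji) mul0n addn0.
have Fi : i \in F.
  by apply: contraTT wb => Fi; rewrite -ltnNge (leq_trans bi) ?leq_weight.
have [m bE] : exists m, b = (m + U_(i) *+ 2)%MM.
  exists (b - U_(i) *+ 2)%MM; rewrite submK //; apply/mnm_lepP => j.
  by rewrite mulmnE mnm1E; case: eqP => [<-|]; rewrite ?mul1n ?mul0n.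
rewrite bE mcoeff_mul_sqX WE (cE F i) //.
by rewrite bE weight_add_face in wb.
Qed.

Lemma pair_sum_regular f h : I (e2 * f - h * e1) -> exists q, I (f - q * e1).
Proof.
move=> If; have [w wE] := fin_all_exists (fun i => local_quotient i If).
have [I0 ID IM] := II.
have compat i j : I ('X_i ^+ 2 * w j - 'X_j ^+ 2 * w i).
  apply: vertex_sum_regular.
  have := idealB II (IM ('X_j ^+ 2) _ (wE i)) (IM ('X_i ^+ 2) _ (wE j)).
  by congr I; ring.
have [W WE] := local_quotients_glue compat; exists W; apply: sq_vars_saturated => i.
by have := idealB II (wE i) (IM e1 _ (WE i)); congr I; ring.
Qed.

Lemma symbolic_square_depth2 : depth_geq max I 2.
Proof.
have maxs f : f \in [:: e1; e2] -> max f.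
  by rewrite !inE => /orP[]/eqP->; [exact: vertex_sum_max | exact: pair_sum_max].
exists [:: e1; e2]; split=> //; apply: regular_seq_pair => //.
- exact: vertex_sum_regular.
- exact: pair_sum_regular.
move=> /(ideal_adjoin_min (loc_max_ideal (to_loc_localization K n))).
move=> /(_ symbolic_square_max maxs); exact: notin_max_ideal1.
Qed.

End SymbolicSquare.

Theorem theorem3p2 (K : fieldType) (n : nat) (D : {set {set 'I_n}})
    (hD : simplicial_complex D) (hdim : 1 <= complex_dim D) :
  let m := @max_ideal K n in
  let I2 := @sr_symbolic_square K n D in
  (depth_geq m I2 2 <->
   depth_geq (ideal_ext (@to_loc K n) m) (ideal_ext (@to_loc K n) I2) 2)
  /\
  (depth_geq m I2 2 <-> ext_leq (diameter (skeleton1_adj D)) 2).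
Proof.
move=> m I2.
have II : is_ideal I2 by exact: symbolic_square_is_ideal.
have local_of_depth : depth_geq m I2 2 ->
    depth_geq (ideal_ext (@to_loc K n) m) (ideal_ext (@to_loc K n) I2) 2.
  apply: depth_geq_loc II _ => [|f]; first exact: to_loc_localization.
  exact: symbolic_square_max.
have close_of_local :
    depth_geq (ideal_ext (@to_loc K n) m) (ideal_ext (@to_loc K n) I2) 2 ->
    close_vertices D.
  move=> /(local_depth2_lift (to_loc_localization K n) II).
  move=> [x [y [mx my regx regy]]] u v; apply: contrapT => far.
  apply: (far_not_regular hD (u := u) (v := v)) mx my regx regy => k uk kv.
  by apply: far; exists k.
have depth_of_close : close_vertices D -> depth_geq m I2 2.
  exact: symbolic_square_depth2.
rewrite diameter_le2P //; split; split=> depth.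
- exact: local_of_depth.
- exact/depth_of_close/close_of_local.
- exact/close_of_local/local_of_depth.
- exact: depth_of_close.
Qed.
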